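(* Let $X_1, X_2$ be Hermitian matrices and let $S_1, S_2$ be positive semidefinite matrices, all of the same size $n\times n$. Then $$\mathrm{Tr}[X_1S_1X_1S_2]+\mathrm{Tr}[X_2S_1X_2S_2] \geq 2 \left| \mathrm{Tr}[X_1S_1X_2S_2]\right| .$$
   Context: All matrices are complex $n\times n$ matrices; positive semidefinite matrices are in particular Hermitian. $\mathrm{Tr}$ denotes the usual (unnormalized) matrix trace. An inequality whose left-hand side is a sum of traces and whose right-hand side is real is understood to mean that the left-hand side is a real number and satisfies the inequality. *)

(* Defs.v *)
From HB Require Import structures.
From mathcomp Require Import all_boot all_order all_algebra.
From mathcomp Require Import complex reals.

Set Implicit Arguments.
Unset Strict Implicit.
Unset Printing Implicit Defensive.

Import Order.TTheory GRing.Theory Num.Theory.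
Local Open Scope ring_scope.
Local Open Scope sesquilinear_scope.

(* In a numClosedFieldType, [0 <= z] says that z is real and nonnegative. *)
Definition psdmx (C : numClosedFieldType) (n : nat) (S : 'M[C]_n) : Prop :=
  S \is hermsymmx /\
  forall v : 'cV[C]_n, 0 <= (v ^t* *m S *m v) 0 0.

(* Main.v *)
Require Import Defs.
From mathcomp Require Import all_boot all_order all_algebra.
From mathcomp Require Import complex reals.

Set Implicit Arguments.
Unset Strict Implicit.
Unset Printing Implicit Defensive.

Import Order.TTheory GRing.Theory Num.Theory.
Local Open Scope ring_scope.
Local Open Scope sesquilinear_scope.

(** The trace defining the mixed term is a Hilbert-Schmidt inner product in
    disguise. Factor the positive semidefinite matrices as [S1 = A A*] and
    [S2 = B B*] and put [Yi = B* Xi A]. As the [Xi] are Hermitian, cyclicity of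
    the trace gives [Tr (Xi S1 Xj S2) = Tr (Yi Yj* )]. The inequality thus says
    that [|Y1|^2 + |Y2|^2 >= 2 |<Y1, Y2>|] for the entrywise inner product,
    which follows entry by entry from the triangle inequality and the
    arithmetic-geometric mean inequality. The factorization is
    [psdmx_factor], the rewriting of the trace is [mxtrace_sandwich], and the
    inequality for the [Yi] is [hilbert_schmidt_AGM]. *)

Section Traces.
Variable C : numClosedFieldType.

Lemma hermsymmx_adjE n (X : 'M[C]_n) : X \is hermsymmx -> X ^t* = X.
Proof. by move=> /is_hermitianmxP {2}->; rewrite expr0 scale1r. Qed.

Lemma adjmxM m n p (A : 'M[C]_(m, n)) (B : 'M[C]_(n, p)) :
  (A *m B) ^t* = B ^t* *m A ^t*.
Proof. by rewrite trmx_mul map_mxM. Qed.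

(** The eigenvalues of [S] are values of its quadratic form at the columns of
    a unitary diagonalizing matrix, hence nonnegative; scaling these columns by
    the square roots of the eigenvalues gives the factor. *)
Lemma psdmx_factor n (S : 'M[C]_n) :
  psdmx S -> exists A : 'M[C]_n, S = A *m A ^t*.
Proof.
case=> hS posS.
have Punit := spectral_unitarymx S.
have := orthomx_spectralP (hermitian_normalmx hS).
set P := spectralmx S in Punit *; set d := spectral_diag S.
rewrite invmx_unitary // => defS.
have d_ge0 i : 0 <= d 0 i.
  (* The test vector is column i of the adjoint of P, a unit eigenvector. *)
  have := posS (P ^t* *m delta_mx i 0).
  rewrite adjmxM trmxCK defS !mulmxA mulmxtVK // -!mulmxA.
  rewrite [P *m (P ^t* *m _)]mulmxA (unitarymxP _) // mul1mx.
  rewrite mul_diag_mx mxE (bigD1 i) //= big1 => [|j /negPf nji].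
    by rewrite !mxE !eqxx conjC1 mul1r mulr1 addr0.
  by rewrite !mxE nji conjC0 mul0r.
exists (P ^t* *m diag_mx (map_mx sqrtC d)).
rewrite adjmxM trmxCK mulmxA tr_diag_mx map_diag_mx -[_ *m _ *m diag_mx _]mulmxA.
rewrite mulmx_diag defS; congr (_ *m diag_mx _ *m _).
apply/rowP=> i; rewrite !mxE /= geC0_conj ?sqrtC_ge0 //.
by rewrite -expr2 sqrtCK.
Qed.

(** Cyclicity of the trace moves the last factor [B^t*] to the front, so that both
    halves of the product are matrices of the form [B^t* *m _ *m A], the second
    one adjoint; this is where [X'] must be its own adjoint. *)
Lemma mxtrace_sandwich n (X X' A B : 'M[C]_n) : X' \is hermsymmx ->
  \tr (X *m (A *m A ^t*) *m X' *m (B *m B ^t*)) =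
  \tr ((B ^t* *m X *m A) *m (B ^t* *m X' *m A) ^t*).
Proof.
move=> /hermsymmx_adjE hX'; rewrite !adjmxM trmxCK hX' !mulmxA.
by rewrite mxtrace_mulC !mulmxA.
Qed.

Lemma mxtrace_mul_adj m n (Y Z : 'M[C]_(m, n)) :
  \tr (Y *m Z ^t*) = \sum_i \sum_j Y i j * (Z i j)^*.
Proof.
by apply: eq_bigr => i _; rewrite mxE; apply: eq_bigr => j _; rewrite !mxE.
Qed.

(** The triangle inequality bounds the left-hand side by the sum of the
    [2 * `|Y i j| * `|Z i j|]. The order of [C] is partial, but these moduli are
    real, so that [2ab <= a^2 + b^2] applies to each pair of entries. *)
Lemma hilbert_schmidt_AGM m n (Y Z : 'M[C]_(m, n)) :
  2 * `|\tr (Y *m Z ^t*)| <= \tr (Y *m Y ^t*) + \tr (Z *m Z ^t*).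
Proof.
rewrite !mxtrace_mul_adj -big_split /=.
apply: (@le_trans _ _ (2 * \sum_i \sum_j `|Y i j * (Z i j)^*|)).
  rewrite ler_pM2l ?ltr0n //; apply: le_trans (ler_norm_sum _ _ _) _.
  by apply: ler_sum => i _; apply: ler_norm_sum.
rewrite mulr_sumr; apply: ler_sum => i _.
rewrite mulr_sumr -big_split /=; apply: ler_sum => j _.
rewrite -!normCK normrM norm_conjC mulr_natl.
by rewrite (real_leif_mean_square_scaled _ _).1 ?normr_real.
Qed.

End Traces.

(* [complex R] is ordered by [x <= y] iff y - x is real and nonnegative, and
   the right-hand side is real, so the inequality includes the assertion that
   the left-hand sum of traces is real. *)
Theorem theorem2p4 (R : realType) (n : nat) (X1 X2 S1 S2 : 'M[R[i]]_n)
    (hX1 : X1 \is hermsymmx) (hX2 : X2 \is hermsymmx)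
    (hS1 : psdmx S1) (hS2 : psdmx S2) :
  \tr (X1 *m S1 *m X1 *m S2) + \tr (X2 *m S1 *m X2 *m S2)
    >= 2 * `|\tr (X1 *m S1 *m X2 *m S2)|.
Proof.
have [A ->] := psdmx_factor hS1; have [B ->] := psdmx_factor hS2.
by rewrite !mxtrace_sandwich //; apply: hilbert_schmidt_AGM.
Qed.
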